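(* Let $t\ge2$, $\zeta=e^{2\pi i/t}$, and let $\lambda=(\lambda_1,\lambda_2)$ be a partition with at most two parts. Then $$s_\lambda(1,\zeta,\dots,\zeta^{t-1},z,z^{-1})=s_\lambda(z,z^{-1})$$ (an equality of Laurent polynomials in $z$, sign included) if and only if either $\lambda$ is a $t$-core, i.e. $\lambda=\operatorname{core}_t(\lambda)$, or $$t\text{ is even and }\lambda=\Bigl(\lambda_2+\tfrac{3t}{2}-1,\ \lambda_2\Bigr)\text{ with }\tfrac t2\le\lambda_2\le t-1.$$ In the second case $\{d_1,d_2,d_3\}=\{3t,t,t\}$ as multisets and $\varepsilon_\lambda=+1$, while, with $j=\lambda_2-\tfrac t2$, $\operatorname{core}_t(\lambda)=\bigl(\tfrac t2-1+j,\,j\bigr)$ and the $t$-quotient of $\lambda$ has the single nonempty component $(2)$, in slot $j$.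
   Context: Let $N=t+2$; for $\lambda=(\lambda_1\ge\dots\ge\lambda_N\ge0)$ (padded with zeros) let $\beta_j=\lambda_j+N-j$ ($j$ is the column of $\beta_j$) and $\beta(\lambda)=\{\beta_1>\dots>\beta_N\}$. The $t$-quotient $(\lambda^{(0)},\dots,\lambda^{(t-1)})$ is computed from this $N$-element beta set: if the elements of $\beta(\lambda)$ congruent to $i$ modulo $t$ are $t\tilde a_1+i>\dots>t\tilde a_{n}+i$, then $\lambda^{(i)}=(\tilde a_1-n+1,\dots,\tilde a_n)$; $\operatorname{core}_t$ is the usual $t$-core. If no residue class modulo $t$ is missed by $\beta(\lambda)$, then either exactly two classes $r_A<r_B$ contain two elements (others one), and $A=\{a_1>a_2\}$, $B=\{b_1>b_2\}$ are the elements in classes $r_A,r_B$; or exactly one class $\{p>q>r\}$ contains three (others one), and $A=\{a_1>a_2\}=\{p,q\}$, $B=\{b_1>b_2\}=\{q,r\}$. Then $d_1=a_1-a_2$, $d_2=b_1-b_2$, $\tilde d_3=a_1+a_2-b_1-b_2$, $d_3=|\tilde d_3|$, and for $\tilde d_3\ne0$, $\varepsilon_\lambda=(-1)^{t+\binom{N+1}{2}}(-1)^{j_{A_1}+j_{B_1}+\operatorname{inv}(b_S)}\operatorname{sgn}(a_1-b_1)\operatorname{sgn}(\tilde d_3)$, where $j_{A_1},j_{B_1}$ are the columns of $a_1,b_1$, $S=\{1,\dots,N\}\setminus\{j_{A_1},j_{B_1}\}$, $b_S$ is the word of residues $\beta_j\bmod t\in\{0,\dots,t-1\}$, $j\in S$,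 in increasing order of $j$, and $\operatorname{inv}$ counts inversions. *)

(* Defs.v *)
From mathcomp Require Import all_boot all_order all_fingroup all_algebra.
From mathcomp Require Import fraction.
From mathcomp Require Import complex.
From mathcomp Require Import reals trigo.

Set Implicit Arguments.
Unset Strict Implicit.
Unset Printing Implicit Defensive.

Import Order.TTheory GRing.Theory Num.Theory.

(* Partitions are nonincreasing sequences of naturals.  Two sequences denote
   the same partition iff their [parts] (positive entries) coincide. *)
Definition parts (lam : seq nat) : seq nat := [seq p <- lam | 0 < p].

(* The beta set in decreasing order; the j-th column (j = 1, ..., n) is the
   entry of index j - 1.  Meant for partitions with at most n positive parts,
   [nth] doing the padding by zeros. *)
Definition beta (n : nat) (lam : seq nat) : seq nat :=
  mkseq (fun j => nth 0 lam j + (n - j.+1)) n.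

(* Inverse of [beta]: the partition (b_1 - (n - 1), ..., b_n - 0) attached to
   a decreasing sequence b_1 > ... > b_n, zero parts removed. *)
Definition unbeta (b : seq nat) : seq nat :=
  parts (mkseq (fun j => nth 0 b j - (size b - j.+1)) (size b)).

(* Elements of the beta set congruent to i modulo t, in decreasing order. *)
Definition residue_class (t n : nat) (lam : seq nat) (i : nat) : seq nat :=
  [seq b <- beta n lam | b %% t == i].

(* The t-core, as in Macdonald (I.1, Example 8): on each runner of the abacus
   the beads are pushed to the lowest positions i, t + i, 2t + i, ...  *)
Definition core (t n : nat) (lam : seq nat) : seq nat :=
  unbeta (sort geq
    (flatten [seq [seq k * t + i | k <- iota 0 (size (residue_class t n lam i))]
             | i <- iota 0 t])).

Definition quotient (t n : nat) (lam : seq nat) (i : nat) : seq nat :=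
  unbeta [seq b %/ t | b <- residue_class t n lam i].

(* The pairs (a1, a2), (b1, b2) for n = t + 2; [None] exactly when some residue
   class is missed.  The classes are listed by increasing residue. *)
Definition pairsAB (t : nat) (lam : seq nat) :
    option ((nat * nat) * (nat * nat)) :=
  let cl := [seq residue_class t (t + 2) lam i | i <- iota 0 t] in
  if all (fun c => 0 < size c) cl then
    match [seq c <- cl | 1 < size c] with
    | [:: [:: a1; a2]; [:: b1; b2]] => Some ((a1, a2), (b1, b2))
    | [:: [:: p; q; r]] => Some ((p, q), (q, r))
    | _ => None
    end
  else None.

Definition inversions (w : seq nat) : nat :=
  #|[set ij : 'I_(size w) * 'I_(size w) |
      (ij.1 < ij.2) && (nth 0 w ij.2 < nth 0 w ij.1)]|.

Section PairData.
Variables (A B : nat * nat).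

Definition d1 : nat := A.1 - A.2.
Definition d2 : nat := B.1 - B.2.
Definition d3t : int :=
  ((A.1)%:Z + (A.2)%:Z - (B.1)%:Z - (B.2)%:Z)%R.
Definition d3 : nat := `|d3t|%N.

(* Only meaningful when d3t is nonzero; it is 0 otherwise. *)
Definition eps (t : nat) (lam : seq nat) : int :=
  let n := t + 2 in
  let bt := beta n lam in
  let jA := (index A.1 bt).+1 in
  let jB := (index B.1 bt).+1 in
  let S := [seq j <- iota 1 n | (j != jA) && (j != jB)] in
  let bS := [seq nth 0 bt j.-1 %% t | j <- S] in
  ((-1) ^+ (t + 'C(n.+1, 2)) * (-1) ^+ (jA + jB + inversions bS)
   * Num.sg ((A.1)%:Z - (B.1)%:Z) * Num.sg d3t)%R.

End PairData.

Local Open Scope ring_scope.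

Definition alternant (F : fieldType) (n : nat) (x : n.-tuple F)
    (b : seq nat) : F :=
  \det (\matrix_(i < n, j < n) tnth x i ^+ nth 0%N b j).

(* The value at x of the Schur polynomial in n variables, as a ratio of
   alternants.  It is the value of the polynomial when the entries of x are
   pairwise distinct, i.e. when the Vandermonde denominator is nonzero; this
   holds at both points where it is used below ([uniq_point2], [uniq_point]). *)
Definition schur (F : fieldType) (n : nat) (lam : seq nat)
    (x : n.-tuple F) : F :=
  alternant x (beta n lam) / alternant x (beta n [::]).

Lemma alternant_delta_neq0 (F : fieldType) (n : nat) (x : n.-tuple F) :
  uniq x -> alternant x (beta n [::]) != 0.
Proof.
move=> ux; rewrite /alternant.
pose a : 'rV[F]_n := \row_i tnth x i.
have -> : \matrix_(i < n, j < n) tnth x i ^+ nth 0%N (beta n [::]) j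
    = (row_perm (perm (@rev_ord_inj n)) (Vandermonde n a))^T.
  apply/matrixP => i j; rewrite !mxE permE.
  by rewrite /beta nth_mkseq // nth_nil add0n.
rewrite det_tr row_permE det_mulmx det_perm mulf_neq0 ?signr_eq0 //.
rewrite det_Vandermonde; apply/prodf_neq0 => i _; apply/prodf_neq0 => j ij.
rewrite !mxE subr_eq0; apply: contraTneq ij => /(tuple_uniqP _ ux) ->.
by rewrite ltnn.
Qed.

Section Point.
Variable R : realType.

Definition zeta (t : nat) : R[i] :=
  (cos (2 * pi / t%:R) +i* sin (2 * pi / t%:R))%C.

(* Laurent polynomials in z over C, viewed inside the field C(z). *)
Definition ratfun := {fraction {poly R[i]}}.

Definition z : ratfun := FracField.tofrac 'X.

Definition point2 : 2.-tuple ratfun := [tuple z; z^-1].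

Definition point (t : nat) : (t + 2).-tuple ratfun :=
  [tuple of [seq FracField.tofrac (zeta t ^+ k)%:P | k <- iota 0 t] ++ point2].

Lemma zetaX (t k : nat) :
  zeta t ^+ k = (cos (k%:R * (2 * pi / t%:R)) +i* sin (k%:R * (2 * pi / t%:R)))%C.
Proof.
elim: k => [|k IHk]; first by rewrite expr0 mul0r cos0 sin0.
rewrite exprSr IHk; have -> : k.+1%:R * (2 * pi / t%:R) = k%:R * (2 * pi / t%:R) + 2 * pi / t%:R :> R.
  by rewrite -natr1 mulrDl mul1r.
rewrite cosD sinD /zeta.
by congr (_ +i* _)%C; rewrite addrC.
Qed.

Lemma zetaX_neq1 (t k : nat) : (0 < k < t)%N -> zeta t ^+ k != 1.
Proof.
case/andP=> k0 kt; have t0 : (0 < t)%N by apply: leq_trans kt.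
rewrite zetaX; apply/eqP => -[+ _].
have -> : k%:R * (2 * pi / t%:R) = (k%:R * pi / t%:R) *+ 2 :> R.
  by rewrite -[RHS]mulr_natl !mulrA [_ * 2]mulrC.
rewrite cos_mulr2n cos2sin2 mulrnBl => /eqP.
rewrite addrAC -mulr_natr mul1r -[2%:R - 1]/(1 + 1 - 1) addrK.
rewrite subr_eq addrC -subr_eq subrr eq_sym mulrn_eq0 /= sqrf_eq0 => /eqP s0.
have : 0 < sin (k%:R * pi / t%:R : R).
  apply: sin_gt0_pi; rewrite divr_gt0 ?mulr_gt0 ?ltr0n ?pi_gt0 //=.
  by rewrite ltr_pdivrMr ?ltr0n // mulrC ltr_pM2l ?pi_gt0 // ltr_nat.
by rewrite s0 ltxx.
Qed.

Lemma zeta_neq0 t : zeta t != 0.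
Proof.
apply/eqP => -[c0 s0].
have := cos2Dsin2 (2 * pi / t%:R : R); rewrite c0 s0 expr0n addr0 => /eqP.
by rewrite eq_sym oner_eq0.
Qed.

Lemma zetaX_inj t : {in gtn t &, injective (fun k => zeta t ^+ k)}.
Proof.
suff H i j : (i < j)%N -> (j < t)%N -> zeta t ^+ i <> zeta t ^+ j.
  move=> i j; rewrite !inE => it jt e.
  by case: (ltngtP i j) => // ij; [case: (H _ _ ij jt) | case: (H _ _ ij it)].
move=> ij jt e; have /eqP H : zeta t ^+ (j - i) != 1.
  by apply: zetaX_neq1; rewrite subn_gt0 ij /= (leq_ltn_trans (leq_subr _ _)).
apply: H; apply: (mulIf (expf_neq0 i (zeta_neq0 t))).
by rewrite -exprD subnK ?mul1r // ltnW.
Qed.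

Lemma z_neq0 : z != 0.
Proof. by rewrite tofrac_eq0 polyX_eq0. Qed.

Lemma z_neqC (c : R[i]) : FracField.tofrac c%:P != z /\
  FracField.tofrac c%:P != z^-1.
Proof.
split.
  rewrite tofrac_eq; apply/eqP => /(congr1 (fun p : {poly _} => size p)).
  by rewrite size_polyX size_polyC; case: eqP.
apply/eqP => /(congr1 (fun x => x * z)).
rewrite mulVf ?z_neq0 // -tofracM -tofrac1 => /eqP.
rewrite tofrac_eq => /eqP/(congr1 (fun p => p.[0])).
by rewrite hornerMX mulr0 hornerC => /eqP; rewrite eq_sym oner_eq0.
Qed.

Lemma uniq_point2 : uniq point2.
Proof.
rewrite /= inE andbT; apply/eqP => /(congr1 (fun x => x * z)).
rewrite mulVf ?z_neq0 // -tofracM -tofrac1 => /eqP.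
rewrite tofrac_eq => /eqP/(congr1 (fun p => p.[0])).
by rewrite hornerMX mulr0 hornerC => /eqP; rewrite eq_sym oner_eq0.
Qed.

Lemma uniq_point (t : nat) : uniq (point t).
Proof.
rewrite cat_uniq uniq_point2 andbT; apply/andP; split.
  rewrite map_inj_in_uniq ?iota_uniq // => i j.
  rewrite !mem_iota !add0n /= => it jt /eqP.
  by rewrite tofrac_eq => /eqP/polyC_inj/zetaX_inj; apply.
apply/hasPn => x xz; apply/mapP => -[k _ xE]; move: xz.
have [/negbTE cz /negbTE czV] := z_neqC (zeta t ^+ k).
by rewrite xE !inE cz czV.
Qed.

End Point.

(* Main.v *)
(* Write {n} for z^n - z^-n.  The t + 2 beta numbers are b1 = l1 + t + 1,
   b2 = l2 + t and 0, ..., t - 1.  At the t-th roots of unity the columns b1, b2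
   of the alternant agree with the columns of their residues r1, r2, so column
   operations split off a Fourier determinant and leave a 2 x 2 determinant in
   z, 1/z.  With m = l1 - l2 + 1, comparison with s_lam(z, 1/z) = {m} / {1}
   becomes
     {m + t} + {m - t} + {r1 - r2} + {b2 - r1} = {m} + {b1 - r2}.
   Only {b1 - r2} can match {m + t}, which forces b2 = t + r2; what then matches
   {m} leaves m = r1 - r2 or m = t + r2 - r1.  Writing b1 = q1 t + r1, the first
   gives q1 = 1, the second 2 (r1 - r2) = (2 - q1) t with q1 = 1, 2 or 3.
   Here q1 = 1 and q1 = 2 are the t-cores, q1 = 3 the exceptional family. *)

Require Import Defs.
From mathcomp Require Import all_boot all_order all_algebra.
From mathcomp Require Import reals perm fraction complex trigo zify ring.

Set Implicit Arguments.
Unset Strict Implicit.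
Unset Printing Implicit Defensive.

Import Order.TTheory GRing.Theory Num.Theory.
Local Open Scope ring_scope.

(** * Alternants at the [t]-th roots of unity followed by two further points *)

Lemma nth_rot (T : Type) (x0 : T) (s : seq T) (k j : nat) :
  (k <= size s)%N -> (j < size s)%N ->
  nth x0 (rot k s) j = nth x0 s ((j + k) %% size s).
Proof.
move=> ks js; rewrite nth_cat size_drop nth_drop.
case: ltnP => jk; first by rewrite modn_small; [congr nth; lia | lia].
rewrite nth_take; last lia.
have -> : (j + k = (j - (size s - k)) + size s)%N by lia.
by rewrite modnDr modn_small //; lia.
Qed.

(** Both alternants pick up the sign of the same column permutation. This serves to put the columns
    of [b1] and [b2] last. *)
Lemma alternant_rot_ratio (F : fieldType) (n : nat) (x : n.-tuple F)
    (k : nat) (b c : seq nat) :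
  (k <= n)%N -> size b = n -> size c = n ->
  alternant x (rot k b) / alternant x (rot k c) = alternant x b / alternant x c.
Proof.
case: n x => [|n] x kn sb sc; first by rewrite (size0nil sb) (size0nil sc).
pose f (j : 'I_n.+1) : 'I_n.+1 := inord ((j + k) %% n.+1).
have f_inj : injective f.
  move=> i j /(congr1 val); rewrite /= !inordK ?ltn_pmod // => /eqP.
  by rewrite eqn_modDr !modn_small // => /eqP/val_inj.
have alt_rot d : size d = n.+1 ->
    alternant x (rot k d) = alternant x d * (-1) ^+ perm f_inj.
  move=> sd; rewrite /alternant.
  transitivity (\det (col_perm (perm f_inj)
      (\matrix_(i < n.+1, j < n.+1) tnth x i ^+ nth 0%N d j))).
    congr (\det _); apply/matrixP => i j; rewrite !mxE permE inordK ?ltn_pmod //.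
    by rewrite nth_rot ?sd.
  by rewrite col_permE det_mulmx det_perm odd_permV.
by rewrite !alt_rot // -mulf_div divff ?signr_eq0 // mulr1.
Qed.

Lemma det_mx22 (R : comPzRingType) (A : 'M[R]_2) :
  \det A = A 0 0 * A 1 1 - A 0 1 * A 1 0.
Proof.
rewrite (expand_det_row _ 0) !big_ord_recl big_ord0 addr0 /cofactor.
rewrite !det_mx11 !mxE /= expr0 expr1 mul1r mulN1r mulrN.
have -> : lift 0 0 = 1 :> 'I_2 by apply: val_inj.
by have -> : lift 1 0 = 0 :> 'I_2 by apply: val_inj.
Qed.

Definition geometric_point (F : fieldType) (t : nat) (w : F) (y : 2.-tuple F) :
    (t + 2).-tuple F :=
  [tuple of [seq w ^+ k | k <- iota 0 t] ++ y].

(** The determinant of the 2 x 2 block that survives the column operations. *)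
Definition reduced_alternant (F : fieldType) (t : nat) (y : 2.-tuple F)
    (b1 b2 : nat) : F :=
  (tnth y 0 ^+ b1 - tnth y 0 ^+ (b1 %% t))
    * (tnth y 1 ^+ b2 - tnth y 1 ^+ (b2 %% t))
  - (tnth y 0 ^+ b2 - tnth y 0 ^+ (b2 %% t))
    * (tnth y 1 ^+ b1 - tnth y 1 ^+ (b1 %% t)).

(* Since w ^+ t = 1, on the first t rows the column of exponent b is the one of
   exponent b %% t, and subtracting the latter leaves a block triangular
   matrix. *)
Lemma alternant_geometric (F : fieldType) (t : nat) (w : F) (y : 2.-tuple F) :
  (0 < t)%N -> w ^+ t = 1 ->
  exists c : F, forall b1 b2 : nat,
    alternant (geometric_point t w y) (rev (iota 0 t) ++ [:: b1; b2])
      = c * reduced_alternant t y b1 b2.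
Proof.
move=> t0 wt.
pose U : 'M[F]_t := \matrix_(i, j) (w ^+ i) ^+ (t - j.+1).
pose W : 'M[F]_(2, t) := \matrix_(i, j) tnth y i ^+ (t - j.+1).
exists (\det U) => b1 b2.
pose b (k : 'I_2) := nth 0%N [:: b1; b2] k.
(* [U *m P] copies the columns of [U] with exponents [b k %% t]; the column of index [i] has
   exponent [t - i.+1]. *)
pose P : 'M[F]_(t, 2) := \matrix_(i, k) (t - i.+1 == b k %% t)%N%:R.
pose Y : 'M[F]_2 := \matrix_(i, k) (tnth y i ^+ b k - tnth y i ^+ (b k %% t)).
have sumP (x : F) k :
    \sum_(j < t) x ^+ (t - j.+1) * P j k = x ^+ (b k %% t).
  have lt_bt : (b k %% t < t)%N by rewrite ltn_pmod.
  have lt_r : (t - (b k %% t).+1 < t)%N by lia.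
  rewrite (bigD1 (Ordinal lt_r)) //= mxE big1 ?addr0 => [|j /eqP jr].
    have -> : (t - (t - (b k %% t).+1).+1 = b k %% t)%N by lia.
    by rewrite eqxx mulr1.
  rewrite mxE (_ : (_ == _) = false) ?mulr0 //; apply/eqP => e; apply: jr.
  by apply: val_inj => /=; have := ltn_ord j; lia.
have nth_b (k : 'I_2) : nth 0%N (rev (iota 0 t) ++ [:: b1; b2]) (t + k) = b k.
  by rewrite nth_cat size_rev size_iota ltnNge leq_addr addKn.
have nth_r (j : 'I_t) :
    nth 0%N (rev (iota 0 t) ++ [:: b1; b2]) j = (t - j.+1)%N.
  rewrite nth_cat size_rev size_iota ltn_ord nth_rev size_iota //.
  by rewrite nth_iota; have := ltn_ord j; lia.
have x_l (i : 'I_t) : tnth (geometric_point t w y) (lshift 2 i) = w ^+ i.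
  rewrite (tnth_nth 0) /= nth_cat size_map size_iota ltn_ord.
  by rewrite (nth_map 0%N) ?size_iota // nth_iota.
have x_r (i : 'I_2) : tnth (geometric_point t w y) (rshift t i) = tnth y i.
  rewrite !(tnth_nth 0) /= nth_cat size_map size_iota ltnNge leq_addr.
  by rewrite addKn.
transitivity (\det (block_mx U 0 W Y *m block_mx 1%:M P 0 1%:M)).
  rewrite mulmx_block !mulmx1 !mulmx0 !addr0 /alternant; congr (\det _).
  apply/matrixP => i j; rewrite mxE.
  case: (split_ordP i) => i' ->; case: (split_ordP j) => j' ->.
  - by rewrite block_mxEul x_l nth_r mxE.
  - rewrite block_mxEur x_l nth_b mxE.
    under eq_bigr do rewrite mxE.
    by rewrite sumP -!exprM mulnC [in RHS]mulnC !exprM (expr_mod _ wt).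
  - by rewrite block_mxEdl x_r nth_r mxE.
  rewrite block_mxEdr x_r nth_b !mxE.
  under eq_bigr do rewrite mxE.
  by rewrite sumP addrC subrK.
rewrite det_mulmx det_lblock det_ublock !det1 !mulr1; congr (_ * _).
by rewrite det_mx22 !mxE.
Qed.

Lemma beta_two (t l1 l2 : nat) :
  beta (t + 2) [:: l1; l2] = [:: (l1 + t).+1, l2 + t & rev (iota 0 t)]%N.
Proof.
apply: (@eq_from_nth _ 0%N) => [|i].
  by rewrite size_mkseq /= size_rev size_iota addn2.
rewrite size_mkseq => it; rewrite nth_mkseq //.
case: i it => [|[|i]] it /=; [lia | lia |].
rewrite nth_nil nth_rev size_iota; last by lia.
by rewrite nth_iota; lia.
Qed.

Lemma beta_nil (n : nat) : beta n [::] = beta n [:: 0; 0]%N.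
Proof. by apply: eq_map => -[|[|j]]; rewrite /= ?nth_nil. Qed.

(** The factor [c] is common to both alternants and cancels; it is nonzero because the denominator
    of [schur] is. *)
Lemma schur_geometric (F : fieldType) (t l1 l2 : nat) (w : F) (y : 2.-tuple F) :
  (0 < t)%N -> w ^+ t = 1 -> uniq (geometric_point t w y) ->
  reduced_alternant t y t.+1 t != 0 /\ schur [:: l1; l2] (geometric_point t w y)
    = reduced_alternant t y (l1 + t).+1 (l2 + t) / reduced_alternant t y t.+1 t.
Proof.
move=> t0 wt ux; have [c alt_c] := alternant_geometric y t0 wt.
have size_beta k1 k2 : size (beta (t + 2) [:: k1; k2]) = (t + 2)%N.
  by rewrite size_mkseq.
have rot_beta k1 k2 : rot 2 (beta (t + 2) [:: k1; k2])
    = rev (iota 0 t) ++ [:: (k1 + t).+1; k2 + t]%N.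
  by rewrite beta_two /rot /= drop0 take0.
have := alternant_delta_neq0 ux; rewrite beta_nil => delta0.
have := alternant_rot_ratio (geometric_point t w y) (k := 2)
  (leq_addl _ _) (size_beta 0%N 0%N) (size_beta 0%N 0%N).
rewrite (divff delta0) !rot_beta alt_c add0n => rot0.
(* If this product vanished, the ratio in [rot0] would be 0, the inverse of 0 being 0. *)
have : c * reduced_alternant t y t.+1 t != 0.
  by apply: contra_eq_neq rot0 => ->; rewrite invr0 mulr0 eq_sym oner_eq0.
rewrite mulf_eq0 negb_or => /andP[c0 D0]; split=> //.
rewrite /schur beta_nil -(alternant_rot_ratio _ (leq_addl t 2)) //.
by rewrite !rot_beta !alt_c !add0n -mulf_div divff // mul1r.
Qed.

Lemma schur_two (F : fieldType) (l1 l2 : nat) (y : 2.-tuple F) :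
  schur [:: l1; l2] y
    = (tnth y 0 ^+ l1.+1 * tnth y 1 ^+ l2 - tnth y 0 ^+ l2 * tnth y 1 ^+ l1.+1)
      / (tnth y 0 - tnth y 1).
Proof.
by rewrite /schur /alternant !det_mx22 !mxE /= addn1 addn0 !expr1 !expr0 mulr1 mul1r.
Qed.

(** * From Laurent polynomials to multisets of exponents *)

(** Multiplying by a power of [X] turns both sums into polynomials; in characteristic zero their
    coefficients determine the multiplicities. *)
Lemma sum_exprz_perm (K : numFieldType) (r s : seq int) :
  let X := FracField.tofrac ('X : {poly K}) in
  reflect (\sum_(n <- r) X ^ n = \sum_(n <- s) X ^ n) (perm_eq r s).
Proof.
move=> X; apply: (iffP idP) => [rs|eq_sum]; first exact: perm_big.
have X0 : X != 0 by rewrite tofrac_eq0 polyX_eq0.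
have [N N_ge] : exists N : nat, forall n, n \in r ++ s -> 0 <= n + N%:Z.
  exists (\sum_(n <- r ++ s) `|n|)%N => n nrs.
  by rewrite (big_rem n nrs) /=; lia.
have sumE q : {subset q <= r ++ s} ->
    (\sum_(n <- q) X ^ n) * X ^ N
      = FracField.tofrac (\sum_(n <- q) 'X^(absz (n + N%:Z)%R)).
  move=> qrs; rewrite rmorph_sum mulr_suml big_seq [RHS]big_seq.
  apply: eq_bigr => n nq; rewrite rmorphXn [RHS]exprnP gez0_abs ?N_ge ?qrs //.
  by rewrite expfzDr.
have coefE q n : {subset q <= r ++ s} -> n \in r ++ s ->
    (\sum_(m <- q) 'X^(absz (m + N%:Z)%R) : {poly K})`_(absz (n + N%:Z)%R)
      = (count_mem n q)%:R.
  move=> qrs nrs; rewrite coef_sum -sum1_count natr_sum big_mkcond [RHS]big_mkcond.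
  rewrite big_seq [RHS]big_seq; apply: eq_bigr => m mq /=; rewrite coefXn.
  have := N_ge m (qrs _ mq); have := N_ge n nrs => n0 m0.
  by rewrite (_ : (_ == _)%N = (m == n)); [case: eqP | lia].
have rsub : {subset r <= r ++ s} by move=> n; rewrite mem_cat => ->.
have ssub : {subset s <= r ++ s} by move=> n; rewrite mem_cat orbC => ->.
apply/allP => n nrs; rewrite /= -(eqr_nat K) -!coefE //; apply/eqP.
congr (nth _ (polyseq _) _); apply/eqP; rewrite -tofrac_eq -!sumE //.
by rewrite eq_sum.
Qed.

(* The Laurent polynomial \sum_n (z^n - z^-n), n ranging over this list, is the
   difference of the two sides of the identity {m + t} + ... = {m} + {b1 - r2}. *)
Definition exponents (t l1 l2 : nat) : seq int :=
  let m : int := l1.+1%:Z - l2%:Z in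
  let r1 : int := ((l1 + t).+1 %% t)%N in
  let r2 : int := ((l2 + t) %% t)%N in
  [:: - m; m - t%:Z; m + t%:Z; r1 - r2; l2%:Z + t%:Z - r1;
      r2 - (l1.+1%:Z + t%:Z)].

(** The left denominator factors as [C * (X - X^-1)]. Once it is cleared, the equality says that
    [reduced_alternant - C * M] vanishes, and expanding this difference produces the exponents. *)
Lemma reduced_alternant_eq (F : fieldType) (X : F) (t l1 l2 : nat) :
  let y := [tuple X; X^-1] in
  X != 0 -> (1 < t)%N -> reduced_alternant t y t.+1 t != 0 ->
  reduced_alternant t y (l1 + t).+1 (l2 + t) / reduced_alternant t y t.+1 t
    = (tnth y 0 ^+ l1.+1 * tnth y 1 ^+ l2 - tnth y 0 ^+ l2 * tnth y 1 ^+ l1.+1)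
      / (tnth y 0 - tnth y 1) <->
  \sum_(n <- exponents t l1 l2) X ^ n
    = \sum_(n <- map -%R (exponents t l1 l2)) X ^ n.
Proof.
move=> y X0 t1 D0; have y0 : tnth y 0 = X by [].
have y1 : tnth y 1 = X^-1 by [].
pose C := (X ^+ t - 1) * (X^-1 ^+ t - 1).
have D0E : reduced_alternant t y t.+1 t = C * (X - X^-1).
  rewrite /reduced_alternant y0 y1 modnn -addn1 modnDl modn_small // /C.
  by rewrite !exprD !expr1 !expr0; ring.
move: D0; rewrite D0E mulf_eq0 negb_or => /andP[C0 M0].
set M := _ ^+ _ * _ ^+ _ - _ ^+ _ * _ ^+ _.
have CM : reduced_alternant t y (l1 + t).+1 (l2 + t) - C * M
    = \sum_(n <- exponents t l1 l2) X ^ n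
      - \sum_(n <- map -%R (exponents t l1 l2)) X ^ n.
  rewrite /reduced_alternant /C /M y0 y1 /exponents /= !big_cons big_nil.
  rewrite -addSn; set r1 := (_ %% t)%N; set r2 := (_ %% t)%N.
  have exprN k : X ^ (- k%:Z) = (X ^+ k)^-1 by rewrite -exprnN.
  rewrite !opprD !opprK !expfzDr // ?exprN !(=^~ exprnP) !exprD !exprVn.
  (* The powers become five independent nonzero variables, in which the identity is rational. *)
  set L1 := X ^+ l1.+1; set L2 := X ^+ l2; set A := X ^+ t.
  set R1 := X ^+ r1; set R2 := X ^+ r2.
  have L10 : L1 != 0 by rewrite expf_neq0.
  have L20 : L2 != 0 by rewrite expf_neq0.
  have A0 : A != 0 by rewrite expf_neq0.
  have R10 : R1 != 0 by rewrite expf_neq0.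
  have R20 : R2 != 0 by rewrite expf_neq0.
  field.
  by rewrite L10 L20 A0 R10 R20.
rewrite y0 y1 invfM mulrA; split=> [/(mulIf (invr_neq0 M0))DM | sumE].
  by apply/eqP; rewrite -subr_eq0 -CM -DM mulrCA divff // mulr1 subrr.
congr (_ / _); apply: (mulIf C0); rewrite divfK // mulrC [RHS]mulrC.
by apply/eqP; rewrite -subr_eq0 [X in _ - X]mulrC CM sumE subrr.
Qed.

Lemma schur_point_eq (R : realType) (t l1 l2 : nat) : (1 < t)%N ->
  schur [:: l1; l2] (point R t) = schur [:: l1; l2] (point2 R) <->
  perm_eq (exponents t l1 l2) (map -%R (exponents t l1 l2)).
Proof.
move=> t1; have t0 : (0 < t)%N by exact: ltnW.
pose w : ratfun R := FracField.tofrac (zeta R t)%:P.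
have pointE : point R t = geometric_point t w (point2 R).
  apply: val_inj => /=; congr (_ ++ _); apply: eq_map => k.
  by rewrite -rmorphXn polyC_exp.
have zt : zeta R t ^+ t = 1.
  rewrite zetaX; have -> : t%:R * (2 * pi / t%:R) = pi *+ 2 :> R.
    by rewrite mulrC divfK ?pnatr_eq0 -?lt0n // mulr_natl.
  by rewrite cos2pi sin2pi.
have wt : w ^+ t = 1.
  by rewrite -rmorphXn -polyC_exp zt polyC1; apply: tofrac1.
have ux : uniq (geometric_point t w (point2 R)).
  by rewrite -pointE; apply: uniq_point.
have [D0 schurE] := schur_geometric l1 l2 t0 wt ux.
rewrite pointE schurE schur_two.
apply: iff_trans (reduced_alternant_eq l1 l2 (z_neq0 R) t1 D0) _.
exact: (rwP (@sum_exprz_perm R[i] _ _)).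
Qed.

(** * The shapes whose exponent multiset is symmetric *)

Lemma perm_opp (s r : seq int) :
  perm_eq r (s ++ map -%R s) -> perm_eq r (map -%R r).
Proof.
move=> rs; rewrite (permPl rs) perm_sym; apply: perm_trans (perm_map -%R rs) _.
by rewrite map_cat (mapK (@opprK _)) perm_catC.
Qed.

Lemma exponents_perm (t l1 l2 q1 q2 r1 r2 : nat) :
  (l2 <= l1)%N -> (r1 < t)%N -> (r2 < t)%N ->
  (l1 + t).+1 = (q1 * t + r1)%N -> (l2 + t = q2 * t + r2)%N ->
  perm_eq (exponents t l1 l2) (map -%R (exponents t l1 l2)) <->
  q2 = 1%N /\
    [\/ q1 = 1, q1 = 2 /\ r1 = r2 | q1 = 3 /\ (2 * r2 = 2 * r1 + t)%N]%N.
Proof.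
move=> l21 r1t r2t e1 e2; rewrite /exponents e1 e2 !modnMDl !modn_small //.
set m : int := _ - _; set e := [:: _ & _]; split=> [/perm_mem e_opp | [q2E]].
  have {e2} [l2E q2E] : l2 = r2 /\ q2 = 1%N.
    (* Since [m > 0], [m + t] exceeds every entry of the negated list except the last,
       [l1 + 1 + t - r2]. *)
    have := e_opp (m + t%:Z); rewrite !inE eqxx !orbT => /esym H.
    have l2E : l2 = r2 by lia.
    by split=> //; nia.
  split=> //.
  (* In the negated list [- m] can only equal [r2 - r1] or [r1 - l2 - t]. *)
  have := e_opp (- m); rewrite mem_head !inE => /esym H.
  have {H} [H|H] : (l1.+1 = r1 \/ l1.+1 + r1 = t + 2 * r2)%N by lia.
    by apply: Or31; nia.
  (* Over the integers [2 * (r1 - r2) = (2 - q1) * t], while [|r1 - r2| < t]. *)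
  have q1_lt4 : (q1 < 4)%N by nia.
  by case: q1 q1_lt4 e1 => [|[|[|[|]]]] // _ e1; constructor; lia.
have l2E : l2 = r2 by lia.
case=> [q1E | [q1E rE] | [q1E rE]]; subst q1 q2.
  apply: (@perm_opp [:: - m; m - t%:Z; m + t%:Z]).
  have -> : e = [:: - m; m - t%:Z; m + t%:Z]
      ++ map -%R [:: - m; m - t%:Z; m + t%:Z]; last by [].
  by rewrite /e /m /=; congr [:: _; _; _; _; _; _]; lia.
(* Now [r1 - r2 = t - m] and [l2 + t - r1 = m], the reverse of the first case; hence the exchange of
   [- m] and [m - t]. *)
all: apply: (@perm_opp [:: m - t%:Z; - m; m + t%:Z]).
all: have -> : e = [:: - m] ++ [:: m - t%:Z]
    ++ (m + t%:Z :: map -%R [:: m - t%:Z; - m; m + t%:Z]);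
  last by rewrite perm_catCA.
all: by rewrite /e /m /=; congr [:: _; _; _; _; _; _]; lia.
Qed.

(** * Cores of two-row shapes on the abacus *)

Lemma unbeta_beta (n : nat) (lam : seq nat) :
  (size lam <= n)%N -> unbeta (beta n lam) = parts lam.
Proof.
move=> ln; rewrite /unbeta size_mkseq.
have -> : mkseq (fun j => nth 0 (beta n lam) j - (n - j.+1))%N n
    = lam ++ nseq (n - size lam) 0%N.
  apply: (@eq_from_nth _ 0%N) => [|j]; rewrite size_mkseq.
    by rewrite size_cat size_nseq subnKC.
  move=> jn; rewrite !nth_mkseq // addnK nth_cat nth_nseq if_same.
  by case: ltnP => // ?; rewrite nth_default.
by rewrite /parts filter_cat filter_nseq mul0n cats0.
Qed.

Lemma parts_two_inj (l1 l2 c1 c2 : nat) : (l2 <= l1)%N -> (c2 <= c1)%N ->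
  parts [:: l1; l2] = parts [:: c1; c2] -> l1 = c1 /\ l2 = c2.
Proof.
by case: l1 l2 c1 c2 => [|l1] [|l2] [|c1] [|c2] //= _ _ [*]; subst.
Qed.

Lemma residue_class_two (t l1 l2 i : nat) : (i < t)%N ->
  residue_class t (t + 2) [:: l1; l2] i
    = [seq b <- [:: (l1 + t).+1; l2 + t]%N | b %% t == i]%N ++ [:: i].
Proof.
move=> it; rewrite /residue_class beta_two (filter_cat _ [:: _; _]).
congr (_ ++ _); rewrite filter_rev.
rewrite (@eq_in_filter _ _ (pred1 i)) => [|b].
  by rewrite filter_pred1_uniq ?iota_uniq // mem_iota.
by rewrite mem_iota /= => bt; rewrite modn_small.
Qed.

(* The beads of the core on the runner i are at positions 0, ..., n_i - 1, with
   n_i the size of the i-th residue class. *)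
Lemma core_two (t l1 l2 c1 c2 : nat) : (0 < t)%N -> (c2 <= c1)%N ->
  (forall b, (b \in beta (t + 2) [:: c1; c2]) =
     (b %/ t < size (residue_class t (t + 2) [:: l1; l2] (b %% t)))%N) ->
  core t (t + 2) [:: l1; l2] = parts [:: c1; c2].
Proof.
move=> t0 c21 mem_beta; rewrite /core -(@unbeta_beta (t + 2)) ?leq_addl //.
congr unbeta.
have geq_trans : transitive geq by move=> x y w /= xy /leq_trans; apply.
have gtn_trans : transitive gtn by move=> x y w /= xy /ltn_trans; apply.
have geq_anti : antisymmetric geq.
  by move=> x y /=; rewrite andbC -eqn_leq => /eqP.
have geq_total : total geq by move=> x y; apply: leq_total.
have beta_sorted : sorted gtn (beta (t + 2) [:: c1; c2]).
  rewrite beta_two /=; apply/andP; split; first by lia.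
  rewrite path_sortedE //.
  rewrite rev_sorted iota_ltn_sorted andbT all_rev.
  by apply/allP => b; rewrite mem_iota /=; lia.
apply: (sorted_eq geq_trans geq_anti).
- exact: sort_sorted.
- by apply: sub_sorted beta_sorted => x y /ltnW.
rewrite perm_sort; apply: uniq_perm.
- apply: allpairs_uniq_dep (iota_uniq _ _) _ _ => [i _|[i k] [i' k']].
    exact: iota_uniq.
  move=> /allpairsPdep[x [y [+ _]]] e /allpairsPdep[x' [y' [+ _]]] e'.
  case: e e' => -> _ [-> _]; rewrite !mem_iota /= => it it' /= eb.
  have xx' : x = x'.
    by have := congr1 (modn^~ t) eb; rewrite /= !modnMDl !modn_small.
  by subst x'; congr existT; nia.
- by apply: (sorted_uniq gtn_trans) beta_sorted => x; apply: ltnn.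
move=> b; rewrite mem_beta; apply/allpairsPdep/idP => [[i [k []]]|bt].
  rewrite !mem_iota /= => it kt ->.
  by rewrite modnMDl modn_small // divnMDl // divn_small // addn0.
exists (b %% t)%N, (b %/ t)%N; rewrite !mem_iota /= ltn_pmod //.
by split=> //; apply: divn_eq.
Qed.

(** Every runner keeps its bottom bead; the two extra beads drop to [t + r1] and [t + r2], or stack
    at [t + r1] and [2t + r1] when the residues agree. *)
Lemma core_two_residues (t l1 l2 : nat) : (0 < t)%N ->
  let r1 := ((l1 + t).+1 %% t)%N in
  let r2 := ((l2 + t) %% t)%N in
  core t (t + 2) [:: l1; l2] =
    parts (if r1 == r2 then [:: t + r1 - 1; r1]
           else [:: maxn r1 r2 - 1; minn r1 r2])%N.
Proof.
move=> t0 r1 r2.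
have r1t : (r1 < t)%N by rewrite ltn_pmod.
have r2t : (r2 < t)%N by rewrite ltn_pmod.
have sizeE b : size (residue_class t (t + 2) [:: l1; l2] (b %% t))
    = ((r1 == b %% t) + (r2 == b %% t) + 1)%N.
  by rewrite residue_class_two ?ltn_pmod // size_cat size_filter /= addn0.
have mem_beads c1 c2 b : (b \in beta (t + 2) [:: c1; c2])
    = [|| b == (c1 + t).+1, b == c2 + t | b < t]%N.
  by rewrite beta_two !inE mem_rev mem_iota.
case: eqP => r12; apply: core_two => [//||b]; try lia;
  rewrite mem_beads sizeE; have := divn_eq b t; have := ltn_pmod b t0.
(* No runner holds more than three beads, so heights from 3 on can be treated together. *)
all: move: (b %/ t)%N (b %% t)%N => q r rt ->; case: q => [|[|[|q]]].
all: rewrite ?mulSn ?mul0n ?addn0; apply/idP/idP; case: eqP; case: eqP.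
all: lia.
Qed.

(** No bead may move: [b2] sits at [t + r2], and [b1] at [t + r1], or at [2t + r1] above [b2] on the
    same runner. *)
Lemma core_two_iff (t l1 l2 q1 q2 r1 r2 : nat) :
  (l2 <= l1)%N -> (r1 < t)%N -> (r2 < t)%N ->
  (l1 + t).+1 = (q1 * t + r1)%N -> (l2 + t = q2 * t + r2)%N ->
  parts [:: l1; l2] = core t (t + 2) [:: l1; l2] <->
  (q2 = 1 /\ (q1 = 1 \/ q1 = 2 /\ r1 = r2))%N.
Proof.
move=> l21 r1t r2t e1 e2; have t0 : (0 < t)%N by lia.
rewrite core_two_residues // e1 e2 !modnMDl !modn_small //; split.
  case: eqP => r12 /parts_two_inj [] //; try lia.
    by move=> l1E l2E; split; [|right; split]; nia.
  by move=> l1E l2E; split; [|left]; nia.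
case=> q2E q1E; subst q2.
by case: eqP => r12; congr (parts [:: _; _]); nia.
Qed.

(** * Pairs, sign, core and quotient of the exceptional family *)

(** Every pair of positions is an inversion. The word [b_S] of an exceptional shape is
    [t - 1, ..., 0]. *)
Lemma inversions_decreasing (w : seq nat) :
  sorted gtn w -> inversions w = 'C(size w, 2).
Proof.
move=> w_sorted; have gtn_trans : transitive gtn.
  by move=> x y v /= xy /ltn_trans; apply.
rewrite /inversions -sum1_card -bin2_sum big_mkord.
transitivity (\sum_(p : 'I_(size w) * 'I_(size w) | (p.2 < p.1)%N) 1)%N.
  rewrite [RHS](reindex (fun p => (p.2, p.1))) /=; last first.
    by exists (fun p => (p.2, p.1)) => -[].
  apply: eq_bigl => -[i j]; rewrite inE /=; apply: andb_idr => ij.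
  by apply: (sorted_ltn_nth gtn_trans 0%N w_sorted) ij; rewrite inE ltn_ord.
rewrite -(pair_big_dep predT (fun i j : 'I_(size w) => (j < i)%N) (fun _ _ => 1%N)).
apply: eq_bigr => i _.
by rewrite (big_ord_narrow (ltnW (ltn_ord i))) sum1_card card_ord.
Qed.

(* The exceptional shapes, with t = 2h and j = l2 - h. *)
Section Exceptional.
Variables (h j : nat).
Hypothesis jh : (j < h)%N.
Let t := (2 * h)%N.
Let lam := [:: 4 * h + j - 1; h + j]%N.

(** The two large beads are [3t + j] and [t + (h + j)], on the distinct runners [j] and [h + j]. *)
Lemma exceptional_residue_class i : (i < t)%N ->
  residue_class t (t + 2) lam i
    = (if i == j then [:: 3 * t + j; j]
       else if i == h + j then [:: t + (h + j); h + j] else [:: i])%N.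
Proof.
move=> it; rewrite residue_class_two //=.
have -> : ((4 * h + j - 1 + t).+1 = 3 * t + j)%N by rewrite /t; lia.
have -> : (h + j + t = t + (h + j))%N by lia.
rewrite modnMDl modnDl !modn_small /t; try lia.
rewrite ![_ == i]eq_sym; case: (eqVneq i j) => [->|_].
  by rewrite ifN //; lia.
by case: eqP => [->|].
Qed.

Lemma exceptional_pairsAB :
  pairsAB t lam = Some ((3 * t + j, j), (t + (h + j), h + j))%N.
Proof.
rewrite /pairsAB; set cl := [seq _ | _ <- _].
have -> : all (fun c => 0 < size c)%N cl.
  rewrite all_map; apply/allP => i; rewrite mem_iota /= => it.
  by rewrite exceptional_residue_class //; case: ifP => // _; case: ifP.
suff -> : [seq c <- cl | 1 < size c]%N
    = [seq residue_class t (t + 2) lam i | i <- [:: j; (h + j)%N]].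
  rewrite /= (exceptional_residue_class (i := j)); last by rewrite /t; lia.
  rewrite exceptional_residue_class; last by rewrite /t; lia.
  by rewrite eqxx ifN ?eqxx //; lia.
rewrite filter_map; congr map.
(* Both lists of residues increase strictly, so equal membership suffices. *)
apply: (irr_sorted_eq ltn_trans ltnn).
- exact: (sorted_filter ltn_trans _ (iota_ltn_sorted _ _)).
- by rewrite /= andbT; lia.
move=> i; rewrite mem_filter mem_iota !inE /=.
case: (ltnP i t) => it; last by rewrite andbF; rewrite /t in it; lia.
by rewrite andbT exceptional_residue_class //; do 2!case: eqP.
Qed.

Lemma exceptional_eps :
  eps (3 * t + j, j)%N (t + (h + j), h + j)%N t lam = 1.
Proof.
rewrite /eps /d3t beta_two /=.
have -> : ((4 * h + j - 1 + t).+1 = 3 * t + j)%N by rewrite /t; lia.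
have -> : (h + j + t = t + (h + j))%N by lia.
have b12 : (3 * t + j == t + (h + j))%N = false by rewrite /t; lia.
rewrite eqxx b12 eqxx.
have -> : [seq k <- iota 1 (t + 2) | (k != 1) && (k != 2)]%N = iota 3 t.
  rewrite addn2 /=; apply/all_filterP/allP => k; rewrite mem_iota; lia.
have -> : [seq nth 0 [:: 3 * t + j, t + (h + j) & rev (iota 0 t)] k.-1 %% t
            | k <- iota 3 t]%N = rev (iota 0 t).
  apply: (@eq_from_nth _ 0%N) => [|k]; rewrite size_map size_iota.
    by rewrite size_rev size_iota.
  move=> kt; rewrite (nth_map 0%N) ?size_iota // nth_iota //= nth_rev size_iota //.
  by rewrite nth_iota ?modn_small; lia.
rewrite inversions_decreasing; last by rewrite rev_sorted iota_ltn_sorted.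
(* Both signs are positive: [a1 - b1 = 2t - h] and [d3t = t]. *)
rewrite size_rev size_iota !gtr0_sg; [|rewrite /t; lia..].
rewrite !mulr1 -exprD !bin2 -signr_odd /t.
have -> : ((2 * h + 2).+1 * (2 * h + 2).+1.-1 = ((2 * h + 3) * (h + 1)).*2)%N by lia.
have -> : (2 * h * (2 * h).-1 = (h * (2 * h).-1).*2)%N by lia.
(* The columns are 1 and 2, so the total exponent is [t + 'C(t + 3, 2) + 3 + 'C(t, 2)], which is
   even for [t = 2h]. *)
rewrite !doubleK (_ : _ + _ = (h * h.*2 + 3 * h + 3).*2)%N ?odd_double //.
(* Writing [h] as a successor makes the truncated [(2 * h).-1] a true predecessor. *)
by case: (h) jh => //= k _; lia.
Qed.

Lemma exceptional_core :
  core t (t + 2) lam = parts [:: h - 1 + j; j]%N.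
Proof.
rewrite core_two_residues; last by rewrite /t; lia.
have -> : ((4 * h + j - 1 + t).+1 = 3 * t + j)%N by rewrite /t; lia.
have -> : (h + j + t = t + (h + j))%N by lia.
rewrite modnMDl modnDl !modn_small /t ?ifN; try lia.
by congr (parts [:: _; _]); lia.
Qed.

(** Runner [j] has beads at heights 3 and 0, which encode [(2)]; on all other runners the beads are
    already packed at the bottom. *)
Lemma exceptional_quotient i : (i < t)%N ->
  quotient t (t + 2) lam i = (if i == j then [:: 2] else [::])%N.
Proof.
move=> it; have t0 : (0 < t)%N by apply: leq_ltn_trans it.
rewrite /quotient exceptional_residue_class //.
case: eqP => [ij|_]; first by rewrite /= divnMDl // divn_small // /t; lia.
case: eqP => [ihj|_]; last by rewrite /= divn_small.
by rewrite /= divnDl // divnn t0 divn_small // /t; lia.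
Qed.

End Exceptional.

Local Close Scope ring_scope.

Theorem theorem5p2 (R : realType) (t l1 l2 : nat) (ht : 2 <= t)
    (hl : l2 <= l1) :
  let lam := [:: l1; l2] in
  let exceptional :=
    [/\ ~~ odd t, l1 = l2 + (3 * t) %/ 2 - 1 & t %/ 2 <= l2 <= t - 1] in
  (schur lam (point R t) = schur lam (point2 R)
     <-> parts lam = core t (t + 2) lam \/ exceptional)
  /\
  (exceptional ->
     (exists A B : nat * nat,
        [/\ pairsAB t lam = Some (A, B),
            perm_eq [:: d1 A; d2 B; d3 A B] [:: 3 * t; t; t]
          & eps A B t lam = 1%R])
     /\
     (let j := l2 - t %/ 2 in
      core t (t + 2) lam = parts [:: t %/ 2 - 1 + j; j]
      /\ forall i : nat, i < t ->
           quotient t (t + 2) lam i = if i == j then [:: 2] else [::])).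
Proof.
move=> lam exceptional; split.
  have t0 : 0 < t by apply: ltnW.
  have r1t := ltn_pmod (l1 + t).+1 t0; have r2t := ltn_pmod (l2 + t) t0.
  have e1 := divn_eq (l1 + t).+1 t; have e2 := divn_eq (l2 + t) t.
  rewrite (schur_point_eq R l1 l2 ht) (exponents_perm hl r1t r2t e1 e2).
  rewrite (core_two_iff hl r1t r2t e1 e2).
  move: e1 e2 r1t r2t; set q1 := _.+1 %/ t; set q2 := _ %/ t.
  set r1 := _.+1 %% t; set r2 := _ %% t => e1 e2 r1t r2t.
  (* In an exceptional shape [b1 = l2 + 5t/2 = 3t + (l2 - t/2)], so that [r1 = l2 - t/2] and
     [r2 = l2]. *)
  have -> : exceptional <-> q2 = 1 /\ q1 = 3 /\ 2 * r2 = 2 * r1 + t.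
    split=> [[t_even l1E l2E]|[q2E [q1E rE]]]; last first.
      by rewrite q1E q2E in e1 e2; split; lia.
    have q2E : q2 = 1 by nia.
    have q1E : q1 = 3 by nia.
    by rewrite q1E q2E in e1 e2 *; split; [|split]; lia.
  split=> [[q2E [q1E|[q1E rE]|[q1E rE]]] | [[q2E [q1E|[q1E rE]]]|[q2E [q1E rE]]]].
  - by left; split; [|left].
  - by left; split; [|right].
  - by right.
  - by split=> //; apply: Or31.
  - by split=> //; apply: Or32.
  - by split=> //; apply: Or33.
move=> [t_even l1E l2E].
have [h tE] : exists h, t = 2 * h by exists (t %/ 2); lia.
have [j l2j] : exists j, l2 = h + j by exists (l2 - h); lia.
have {l1E} l1j : l1 = 4 * h + j - 1 by lia.
have jh : j < h by lia.
have -> : t %/ 2 = h by lia.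
have -> : l2 - h = j by lia.
rewrite /lam {lam exceptional}; subst t l1 l2; split.
  exists (3 * (2 * h) + j, j), (2 * h + (h + j), h + j); split.
  - exact: exceptional_pairsAB.
  - rewrite /d1 /d2 /d3 /d3t /= (_ : 3 * _ + j - j = 3 * (2 * h)); last lia.
    rewrite (_ : _ - (h + j) = 2 * h); last lia.
    by rewrite (_ : absz _ = 2 * h) //; lia.
  - exact: exceptional_eps.
split; first exact: exceptional_core.
by move=> i; apply: exceptional_quotient.
Qed.
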